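(* Let $n\geq 2$ and let $\mathcal{G}=\{G_1, G_2, \ldots , G_{2n-1}\}$ be a family of (not necessarily distinct) balanced bipartite graphs on the common vertex set $[2n]$ with the common bipartition $(X, Y)$. If $$\rho (G_i) \geq \rho(K_{n,n-1}\cup K_1)$$ for every $i\in [2n-1]$, then $\mathcal{G}$ admits a rainbow Hamilton path unless $G_1=G_2=\cdots =G_{2n-1}\cong K_{n,n-1}\cup K_1$.
   Context: All graphs are simple and undirected. $[k]=\{1,2,\ldots,k\}$. A bipartite graph with bipartition $(X,Y)$ is balanced if $|X|=|Y|$. $\rho(G)$ is the spectral radius of $G$, i.e. the maximum modulus of the eigenvalues of its adjacency matrix. $G\cup H$ denotes disjoint union, and $K_{s,t}$ the complete bipartite graph. $G_i=G_j$ means equality as graphs on the labelled vertex set (same edge set), while $\cong$ denotes isomorphism. For a family $\mathcal{G}=\{G_1,\ldots,G_k\}$ of not necessarily distinct graphs on the same vertex set $V$ and a graph $H$ with $k$ edges and $V(H)\subseteq V$, $H$ is a rainbow copy in $\mathcal{G}$ if there is a bijection $\phi:E(H)\to[k]$ with $e\in E(G_{\phi(e)})$ for all $e\in E(H)$. A rainbow Hamilton path in $\mathcal{G}$ is such an $H$ that is a path visiting every vertex of $V$ exactly once. *)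

(* Defs.v *)
From mathcomp Require Export all_boot all_order all_algebra all_field.

Set Implicit Arguments.
Unset Strict Implicit.
Unset Printing Implicit Defensive.

Import Order.TTheory GRing.Theory Num.Theory.

Record sgraph (V : finType) := SGraph {
  adj :> rel V;
  adj_sym : symmetric adj;
  adj_irr : irreflexive adj }.

Section Graphs.
Variable V : finType.
Implicit Types G H : sgraph V.

Definition edges G : {set {set V}} :=
  [set [set p.1; p.2] | p : V * V & adj G p.1 p.2].

Definition balanced_bipartite G (X Y : {set V}) : Prop :=
  [/\ [disjoint X & Y], X :|: Y = [set: V], #|X| = #|Y| &
      forall x y, adj G x y ->
        (x \in X) && (y \in Y) || (x \in Y) && (y \in X)].

(* phi is a bijection from the edges of H onto the index set; its values on
   sets that are not edges of H are irrelevant. *)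
Definition rainbow_copy k (F : 'I_k -> sgraph V) H : Prop :=
  exists phi : {set V} -> 'I_k,
    [/\ {in edges H &, injective phi},
        phi @: edges H = [set: 'I_k] &
        forall e, e \in edges H -> e \in edges (F (phi e))].

(* [infix [:: x; y] s] says that y immediately follows x in s. *)
Definition hamilton_path H : Prop :=
  exists s : seq V,
    [/\ uniq s, forall x, x \in s &
        forall x y, adj H x y = infix [:: x; y] s || infix [:: y; x] s].

Definition has_rainbow_hamilton_path k (F : 'I_k -> sgraph V) : Prop :=
  exists H, hamilton_path H /\ rainbow_copy F H.

End Graphs.

Definition isomorphic (V W : finType) (G : sgraph V) (H : sgraph W) : Prop :=
  exists2 f : V -> W, bijective f & forall x y, adj H (f x) (f y) = adj G x y.

Section Constructions.

Definition Kn_adj r : rel 'I_r := fun x y => x != y.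
Fact Kn_sym r : symmetric (@Kn_adj r).
Proof. by move=> x y; rewrite /Kn_adj eq_sym. Qed.
Fact Kn_irr r : irreflexive (@Kn_adj r).
Proof. by move=> x; rewrite /Kn_adj eqxx. Qed.
Definition complete_graph r : sgraph 'I_r := SGraph (@Kn_sym r) (@Kn_irr r).

Definition Kst_adj s t : rel ('I_s + 'I_t)%type := fun u v =>
  match u, v with inl _, inr _ | inr _, inl _ => true | _, _ => false end.
Fact Kst_sym s t : symmetric (@Kst_adj s t).
Proof. by case=> [x|x] [y|y]. Qed.
Fact Kst_irr s t : irreflexive (@Kst_adj s t).
Proof. by case. Qed.
Definition complete_bipartite s t : sgraph ('I_s + 'I_t)%type :=
  SGraph (@Kst_sym s t) (@Kst_irr s t).

Variables (V W : finType) (G : sgraph V) (H : sgraph W).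
Definition union_adj : rel (V + W)%type := fun u v =>
  match u, v with
  | inl x, inl y => adj G x y
  | inr x, inr y => adj H x y
  | _, _ => false
  end.
Fact union_sym : symmetric union_adj.
Proof. by case=> [x|x] [y|y] //=; apply: adj_sym. Qed.
Fact union_irr : irreflexive union_adj.
Proof. by case=> x /=; apply: adj_irr. Qed.
Definition disjoint_union : sgraph (V + W)%type := SGraph union_sym union_irr.

End Constructions.

Local Open Scope ring_scope.

Section SpectralRadius.
Variable n : nat.
Implicit Type A : 'M[algC]_n.

(* The matrices of interest have integer entries, so algC contains all their
   complex eigenvalues. *)
Definition eigenvalues A : seq algC :=
  sval (closed_field_poly_normal (char_poly A)).

(* Num.max is applied only to norms, which are real, hence comparable. *)
Definition spectral_radius A : algC :=
  \big[Num.max/0]_(z <- eigenvalues A) `|z|.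

Lemma mem_eigenvalues A z : (z \in eigenvalues A) = eigenvalue A z.
Proof.
rewrite eigenvalue_root_char /eigenvalues.
case: closed_field_poly_normal => r /= ->.
by rewrite (monicP (char_poly_monic A)) scale1r root_prod_XsubC.
Qed.

Lemma spectral_radius_max A z : eigenvalue A z -> `|z| <= spectral_radius A.
Proof.
rewrite -mem_eigenvalues /spectral_radius.
have R0 (s : seq algC) : \big[Num.max/0]_(y <- s) `|y| \is Num.real.
  elim/big_ind: _ => // x y; first by rewrite /Num.max; case: ifP.
  exact: normr_real.
elim: (eigenvalues A) => //= x s IHs; rewrite big_cons inE.
rewrite comparable_le_max; last by rewrite real_comparable ?normr_real.
by case/orP=> [/eqP->|/IHs->]; rewrite ?lexx ?orbT.
Qed.

Lemma spectral_radius_attained A :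
  (0 < n)%N -> exists2 z, eigenvalue A z & `|z| = spectral_radius A.
Proof.
move=> n_gt0; suff [z zA] : exists z, eigenvalue A z.
  move/spectral_radius_max: (zA) => z_le.
  suff [e|[y yA e]] : spectral_radius A = 0 \/
      exists2 y, eigenvalue A y & `|y| = spectral_radius A.
  - by exists z => //; apply/eqP; rewrite eq_le z_le e normr_ge0.
  - by exists y.
  rewrite /spectral_radius.
  have: {subset eigenvalues A <= eigenvalue A}.
    by move=> y; rewrite mem_eigenvalues.
  elim: (eigenvalues A) => [|x s IHs] sA; first by left; rewrite big_nil.
  rewrite big_cons /Num.max; case: ifP => _.
    by apply: IHs => y ys; apply: sA; rewrite inE ys orbT.
  by right; exists x => //; apply: sA; rewrite inE eqxx.
have/closed_rootP [z zr] : size (char_poly A) != 1%N.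
  by rewrite size_char_poly eqSS -lt0n.
by exists z; rewrite eigenvalue_root_char.
Qed.

End SpectralRadius.

Definition adjacency_matrix (V : finType) (G : sgraph V) : 'M[algC]_#|V| :=
  \matrix_(i, j) (adj G (enum_val i) (enum_val j))%:R.

Definition rho (V : finType) (G : sgraph V) : algC :=
  spectral_radius (adjacency_matrix G).

(* K_{n,n-1} \cup K_1 *)
Definition extremal_graph n :=
  disjoint_union (complete_bipartite n n.-1) (complete_graph 1).

(* Main.v *)
Require Import Defs.
From mathcomp Require Import all_boot all_order all_algebra all_field.
From mathcomp Require Import zify.

Set Implicit Arguments.
Unset Strict Implicit.
Unset Printing Implicit Defensive.
Import Order.TTheory GRing.Theory Num.Theory.

(** Every eigenvalue z of a bipartite graph satisfies |z|^2 <= e (sum the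
Cauchy-Schwarz bound at each vertex over each part), with equality only for a
complete bipartite graph plus isolated vertices; hence each G_i misses a set
M_i of at most n edges of K_{n,n}. Let m(e) be the number of i with e in M_i,
and let D consist of n - 1 edges of K_{n,n} with the largest m. Some Hamilton
path P avoids D. A violation of Hall's condition for assigning the edges of P
to the colours is a set S of s edges, 1 <= s <= n, that lies in M_i for at
least 2n - s indices i, so the n - 1 + s edges e of S :|: D all have
m(e) >= 2n - s, and double counting gives
(n - 1 + s)(2n - s) <= n(2n - 1), that is (s - 1)(n - s) <= 0.
If s = n then M_i = S for at least n indices, which leaves at most n - 1
indices for an edge of D; if s = 1 then every M_i equals S :|: D, so every
G_i has n(n - 1) edges and equality holds in the spectral bound. *)

(** * Rainbow assignment *)

Lemma bigcup_setDl (T U : finType) (A : {set T}) (r : T -> {set U}) (N : {set U}) :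
  \bigcup_(x in A) (r x :\: N) = (\bigcup_(x in A) r x) :\: N.
Proof.
apply/setP=> u; rewrite inE; apply/bigcupP/andP => [[x xA]|[uN /bigcupP[x xA ux]]].
  by rewrite inE => /andP[uN ux]; split=> //; apply/bigcupP; exists x.
by exists x; rewrite // inE uN.
Qed.

(** Induction on [#|A|]. If some nonempty proper subset [S] is tight, [S] is matched first and the
    rest of [A] is matched outside the neighbourhood of [S]. Otherwise some [x] is matched to any
    candidate [y], and [y] is withdrawn. The point [u0] only supplies values off [A]. *)
Lemma hall_marriage (T U : finType) (A : {set T}) (r : T -> {set U}) (u0 : U) :
    (forall S : {set T}, S \subset A -> #|S| <= #|\bigcup_(x in S) r x|) ->
  exists f : T -> U,
    {in A &, injective f} /\ (forall x, x \in A -> f x \in r x).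
Proof.
have [k] := ubnP #|A|; elim: k => // k IHk in A r * => ltAk hallA.
have [->|[x xA]] := set_0Vmem A.
  by exists (fun=> u0); split=> [x y|x]; rewrite inE.
case: (pickP [pred S : {set T} |
    [&& S \proper A, S != set0 & #|\bigcup_(x in S) r x| <= #|S|]]).
- move=> S /and3P[ltSA S0 tight].
  have sSA := proper_sub ltSA.
  have [||f [f_inj f_r]] := IHk S r.
  + by have := proper_card ltSA; lia.
  + by move=> R sRS; apply: hallA (subset_trans sRS sSA).
  set N := \bigcup_(x in S) r x in tight *.
  have [||g [g_inj g_r]] := IHk (A :\: S) (fun x => r x :\: N).
  + have := cardsID S A; rewrite (setIidPr sSA) => eA.
    by move: S0; rewrite -card_gt0; lia.
  (* Hall's condition for [S :|: R], minus the at most [#|S|] elements of [N], gives the condition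
     for [R] in the reduced sets. *)
  + move=> R; rewrite subsetD => /andP[sRA dRS].
    have := hallA (S :|: R); rewrite subUset sSA sRA => /(_ isT).
    rewrite bigcup_setU -/N cardsU (disjoint_setI0 (_ : [disjoint S & R])).
      rewrite cards0 subn0 bigcup_setDl.
      rewrite cardsU -(cardsID N (\bigcup_(x in R) r x)) (setIC N).
      by lia.
    by rewrite disjoint_sym.
  have fN y : y \in S -> f y \in N.
    by move=> yS; apply/bigcupP; exists y; last exact: f_r.
  have gN y : y \in A -> y \notin S -> (g y \notin N) && (g y \in r y).
    by move=> yA yS; have := g_r y; rewrite !inE yA yS => /(_ isT).
  exists (fun y => if y \in S then f y else g y); split.
    move=> y y' yA y'A; case: ifPn => yS; case: ifPn => y'S.
    + exact: f_inj.
    + by move=> e; have /andP[] := gN _ y'A y'S; rewrite -e fN.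
    + by move=> e; have /andP[] := gN _ yA yS; rewrite e fN.
    + by apply: g_inj; rewrite inE ?yS ?y'S.
  by move=> y yA; case: ifPn => [/f_r//|yS]; have /andP[] := gN _ yA yS.
- move=> slack.
  have [y yx] : exists y, y \in r x.
    apply/set0Pn; rewrite -card_gt0.
    by have := hallA [set x]; rewrite sub1set xA cards1 big_set1 => /(_ isT).
  have [||f [f_inj f_r]] := IHk (A :\ x) (fun z => r z :\ y).
  + by have := cardsD1 x A; rewrite xA; lia.
  (* A nonempty [R] inside [A :\ x] is proper in [A], hence not tight: it has a surplus of at least
     one, which pays for the loss of [y]. *)
  + move=> R sR; have [->|R0] := eqVneq R set0; first by rewrite cards0.
    have /= := slack R; rewrite R0 /= (sub_proper_trans sR) ?properD1 //= => /negbT.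
    rewrite -ltnNge => lt.
    rewrite bigcup_setDl.
    by move: lt; rewrite (cardsD1 y (\bigcup_(z in R) r z)); lia.
  have fy z : z \in A -> z != x -> (f z != y) && (f z \in r z).
    by move=> zA zx; have := f_r z; rewrite !inE zA zx => /(_ isT).
  exists (fun z => if z == x then y else f z); split.
    move=> z z' zA z'A; case: eqVneq => [->|zx]; case: eqVneq => [->|z'x] //.
    + by move=> e; have := fy _ z'A z'x; rewrite -e eqxx.
    + by move=> e; have := fy _ zA zx; rewrite e eqxx.
    + by apply: f_inj; rewrite !inE ?zx ?z'x.
  by move=> z zA; case: eqVneq => [->//|zx]; have /andP[] := fy _ zA zx.
Qed.

(** Greedy choice: an element of largest [m] among those left is added at each stage. *)
Lemma top_subset (T : finType) (A : {set T}) (m : T -> nat) k :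
    k <= #|A| ->
  exists D : {set T}, [/\ D \subset A, #|D| = k &
    forall x y, x \in D -> y \in A :\: D -> m y <= m x].
Proof.
elim: k => [_|k IHk ltkA].
  by exists set0; rewrite sub0set cards0; split=> // x y; rewrite inE.
have [D [sDA cD top]] := IHk (ltnW ltkA).
have /card_gt0P[z0 z0A] : 0 < #|A :\: D|.
  by rewrite cardsD (setIidPr sDA) cD; lia.
have [z zAD zmax] := arg_maxnP m z0A.
have : z \in A :\: D by []; rewrite inE => /andP[zD zA].
exists (z |: D); split; first by rewrite subUset sub1set zA.
  by rewrite cardsU1 zD cD.
move=> x y xzD yAzD; have yAD : y \in A :\: D.
  by move: yAzD; rewrite !inE negb_or -andbA => /and3P[_ -> ->].
by move: xzD; rewrite !inE => /orP[/eqP->|/top->//]; apply: zmax.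
Qed.

Lemma sum_multiplicity (T I : finType) (B : {set T}) (M : I -> {set T}) :
  \sum_(e in B) #|[set i | e \in M i]| = \sum_i #|M i :&: B|.
Proof.
transitivity (\sum_(e in B) \sum_i (e \in M i)).
  by apply: eq_bigr => e _; rewrite -sum1dep_card big_mkcond.
rewrite exchange_big; apply: eq_bigr => i _ /=.
rewrite -sum1_card big_mkcond [RHS]big_mkcond; apply: eq_bigr => e _.
by rewrite inE andbC; case: (e \in B); case: (e \in M i).
Qed.

(** Pigeonhole: [z] can go after any element of [p :: s], which makes [size s + 1] gaps. Each
    failing relation [R q z] or [R z q] blocks only the gap next to [q], so one gap stays open. *)
Lemma insert_in_path (T : eqType) (R : rel T) (z p : T) (s : seq T) :
    path R p s ->
    count (fun q => ~~ R q z) (p :: s) + count (fun q => ~~ R z q) s <= size s ->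
  exists s1 s2, s = s1 ++ s2 /\ path R p (s1 ++ z :: s2).
Proof.
elim: s p => [|q s IHs] p /=.
  by move=> _ h; exists [::], [::]; split=> //=; move: h; case: (R p z).
move=> /andP[Rpq Rqs] h.
case Rpz: (R p z); last first.
  have [|s1 [s2 [-> ?]]] := IHs q Rqs; first by move: h; rewrite Rpz /=; lia.
  by exists (q :: s1), s2; rewrite /= Rpq.
case Rzq: (R z q); first by exists [::], (q :: s); rewrite /= Rpz Rzq.
have [|s1 [s2 [-> ?]]] := IHs q Rqs; first by move: h; rewrite Rzq Rpz /=; lia.
by exists (q :: s1), s2; rewrite /= Rpq.
Qed.

(** The same count with the gap in front of the first element included; if that gap is blocked, it
    has used up one of the failures. *)
Lemma insert_in_sorted (T : eqType) (R : rel T) (z : T) (s : seq T) :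
    sorted R s ->
    count (fun q => ~~ R q z) s + count (fun q => ~~ R z q) s <= size s ->
  exists s1 s2, s = s1 ++ s2 /\ sorted R (s1 ++ z :: s2).
Proof.
case: s => [|p s] /=; first by exists [::], [::].
move=> Rps h; case Rzp: (R z p); first by exists [::], (p :: s); rewrite /= Rzp.
have [|s1 [s2 [-> ?]]] := @insert_in_path _ R z p s Rps.
  by move: h; rewrite Rzp /=; lia.
by exists (p :: s1), s2.
Qed.

(* The path a_1 b_1 a_2 b_2 ... a_n b_n is encoded by the pairs (a_i, b_i). *)
Lemma hamilton_path_avoiding (T : finType) n (A B : {set T}) (D : {set T * T}) :
    #|A| = n -> #|B| = n -> D \subset setX A B -> #|D| <= n.-1 ->
  exists s : seq (T * T),
    [/\ perm_eq (unzip1 s) (enum A), perm_eq (unzip2 s) (enum B),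
        all (fun p => p \notin D) s &
        sorted (fun p q => (q.1, p.2) \notin D) s].
Proof.
elim: n => [|n IHn] in A B D *.
  move=> /eqP/[!cards_eq0]/eqP-> /eqP/[!cards_eq0]/eqP-> _ _.
  by exists [::]; rewrite enum_set0.
move=> cA cB sD cD.
(* The edge [(x0, y0)] is to be allowed, while [x0] meets an edge of [D] whenever [D] is nonempty.
   Removing both ends then destroys an edge of [D], so the bound on [#|D|] drops along with [n]. *)
have [x0 [y0 [x0A y0B xyD hit]]] : exists x0 y0, [/\ x0 \in A, y0 \in B,
    (x0, y0) \notin D & #|D :&: setX (A :\ x0) (B :\ y0)| <= n.-1].
  have [->|[[x0 y] xyD]] := set_0Vmem D.
    have /card_gt0P[x0 x0A] : 0 < #|A| by rewrite cA.
    have /card_gt0P[y0 y0B] : 0 < #|B| by rewrite cB.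
    by exists x0, y0; split; rewrite ?set0I ?cards0 ?inE.
  have x0A : x0 \in A by have := subsetP sD _ xyD; rewrite inE => /andP[].
  (* If [D] joined [x0] to all of [B], it would have at least [n.+1] edges. *)
  have : ~~ (B \subset [set y | (x0, y) \in D]).
    apply: contraTN (cD) => sBD; rewrite -ltnNge /= -cB.
    have inj : injective (pair x0 : T -> T * T) by move=> y1 y2 [].
    rewrite -(card_imset _ inj) subset_leq_card //.
    by apply/subsetP=> _ /imsetP[y1 /(subsetP sBD)/[!inE] ? ->].
  case/subsetPn=> y0 y0B; rewrite inE => xyD0; exists x0, y0; split=> //.
  have : #|D :&: setX (A :\ x0) (B :\ y0)| < #|D|.
    apply: proper_card; apply/properP; split; first exact: subsetIl.
    by exists (x0, y); rewrite // !inE eqxx /= andbF.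
  by lia.
have cA1 : #|A :\ x0| = n by have := cardsD1 x0 A; rewrite x0A cA; lia.
have cB1 : #|B :\ y0| = n by have := cardsD1 y0 B; rewrite y0B cB; lia.
have [|s [pA pB /allP avoid srt]] := IHn _ _ _ cA1 cB1 _ hit.
  exact: subsetIr.
have sz : size s = n by rewrite -(size_map fst) (perm_size pA) -cardE.
have [pA0 pB0] : perm_eq (x0 :: unzip1 s) (enum A) /\ perm_eq (y0 :: unzip2 s) (enum B).
  split.
    apply: (perm_trans (y := x0 :: enum (A :\ x0))); first by rewrite perm_cons.
    apply: uniq_perm; rewrite ?enum_uniq //= ?enum_uniq ?mem_enum ?inE ?eqxx //.
    by move=> x; rewrite inE !mem_enum !inE; case: eqVneq => // ->.
  apply: (perm_trans (y := y0 :: enum (B :\ y0))); first by rewrite perm_cons.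
  apply: uniq_perm; rewrite ?enum_uniq //= ?enum_uniq ?mem_enum ?inE ?eqxx //.
  by move=> y; rewrite inE !mem_enum !inE; case: eqVneq => // ->.
have [uA uB] : uniq (unzip1 s) /\ uniq (unzip2 s).
  by rewrite (perm_uniq pA) (perm_uniq pB) !enum_uniq.
have sAB p : p \in s -> (p.1 \in A :\ x0) && (p.2 \in B :\ y0).
  move=> ps; rewrite -(mem_enum (mem (A :\ x0))) -(mem_enum (mem (B :\ y0))).
  by rewrite -(perm_mem pA) -(perm_mem pB) !map_f.
have avoid_in x y : x \in A :\ x0 -> y \in B :\ y0 ->
    (x, y) \notin D :&: setX (A :\ x0) (B :\ y0) -> (x, y) \notin D.
  by move=> xA yB; apply: contra => xyD1; apply/setIP; split=> //; apply/setXP.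
have srtD : sorted (fun p q => (q.1, p.2) \notin D) s.
  have /allP/sub_in_sorted := sAB; apply; last exact: srt.
  by move=> p q /andP[_ pB1] /andP[qA1 _]; apply: avoid_in.
have avoidD p : p \in s -> p \notin D.
  move=> ps; have /andP[p1 p2] := sAB _ ps; have := avoid _ ps.
  by case: p p1 p2 {ps} => x y; apply: avoid_in.
(* Each edge of D blocks at most one of the n + 1 places where x0 y0 can be
   inserted. *)
have count_hits : count (fun q => ~~ ((x0, q.2) \notin D)) s +
    count (fun q => ~~ ((q.1, y0) \notin D)) s <= size s.
  set f := fun _ => _; set g := fun _ => _.
  rewrite sz; apply: leq_trans cD.
  (* The blocking edges: those at [x0] forbid entering [x0] from the preceding pair, those at [y0]
     forbid leaving [y0] for the next pair. No edge occurs in both halves, as [q.1] is never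
     [x0]. *)
  pose L := [seq (x0, q.2) | q <- s & f q] ++ [seq (q.1, y0) | q <- s & g q].
  have -> : count f s + count g s = size L by rewrite size_cat !size_map !size_filter.
  have uL : uniq L.
    rewrite cat_uniq; apply/and3P; split.
    - rewrite (map_comp (pair x0) snd) map_inj_uniq; last by move=> ? ? [].
      exact: subseq_uniq (map_subseq _ (filter_subseq _ _)) uB.
    - apply/hasPn=> _ /mapP[q + ->]; rewrite mem_filter => /andP[_ qs].
      apply/mapP=> -[q' _ [e _]]; have /andP[] := sAB _ qs.
      by rewrite inE e inE eqxx.
    - rewrite (map_comp (fun x => (x, y0)) fst) map_inj_uniq; last by move=> ? ? [].
      exact: subseq_uniq (map_subseq _ (filter_subseq _ _)) uA.
  rewrite -(card_uniqP uL) subset_leq_card //; apply/subsetP=> p.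
  rewrite mem_cat => /orP[] /mapP[q + ->]; rewrite mem_filter => /andP[+ _];
  by rewrite /f /g negbK.
have [s1 [s2 [es srt2]]] :=
  insert_in_sorted (z := (x0, y0)) srtD count_hits.
exists (s1 ++ (x0, y0) :: s2); split=> //.
- apply: perm_trans pA0; rewrite es /unzip1 !map_cat /=.
  by rewrite -cat1s perm_catCA.
- apply: perm_trans pB0; rewrite es /unzip2 !map_cat /=.
  by rewrite -cat1s perm_catCA.
- apply/allP=> p; rewrite mem_cat inE orbCA -mem_cat -es => /orP[/eqP->//|].
  exact: avoidD.
Qed.

(** Here [K] plays the edge set of $K_{n,n}$ and [M i] the edges missing in colour [i]. The set [D]
    does not depend on [P], so a Hamilton path can be chosen to avoid [D] before its edges are
    coloured. *)
Lemma rainbow_assignment (E I : finType) n (K : {set E}) (M : I -> {set E}) :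
    #|I| = 2 * n - 1 -> 2 <= n -> n.-1 <= #|K| ->
    (forall i, M i \subset K) -> (forall i, #|M i| <= n) ->
  (exists D : {set E}, [/\ D \subset K, #|D| = n.-1 &
     forall P : {set E}, P \subset K :\: D -> #|P| <= 2 * n - 1 ->
     exists phi : E -> I,
       {in P &, injective phi} /\ (forall e, e \in P -> e \notin M (phi e))]) \/
  (exists2 S : {set E}, #|S| = n & forall i, M i = S).
Proof.
move=> cI n2 cK sMK cM.
have /card_gt0P[i1 _] : 0 < #|I| by rewrite cI; lia.
pose m e := #|[set i | e \in M i]|.
have [D [sDK cD heavy]] := top_subset m cK.
(* Colour [i] is usable on some edge of [S] exactly when [S] is not inside [M i]; the last condition
   is thus a violation of Hall's condition by [S]. *)
have [/existsP[S /and4P[S0 sSKD sN viol]]|/existsPn noviol] :=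
    boolP [exists S : {set E},
    [&& S != set0, S \subset K :\: D, #|S| <= 2 * n - 1 &
        #|[set i | ~~ (S \subset M i)]| < #|S|]]; last first.
  left; exists D; split=> // P sP cP.
  have [S sSP|f [f_inj fM]] :=
      @hall_marriage _ _ P (fun e => [set i | e \notin M i]) i1.
    have [->|S0] := eqVneq S set0; first by rewrite cards0.
    have := noviol S; rewrite S0 (subset_trans sSP sP) /=.
    rewrite (leq_trans (subset_leq_card sSP) cP) /= -leqNgt.
    move/leq_trans; apply; apply: subset_leq_card; apply/subsetP=> i.
    rewrite inE => /subsetPn[e eS eM]; apply/bigcupP; exists e => //.
    by rewrite inE.
  by exists f; split=> // e /fM; rewrite inE.
right.
pose U := [set i | S \subset M i].
have cU : #|U| + #|[set i | ~~ (S \subset M i)]| = 2 * n - 1.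
  rewrite -[RHS]cI -(cardC (mem U)); congr addn.
  by apply: eq_card => i; rewrite !inE.
have cU_ge : 2 * n - #|S| <= #|U| by lia.
have /card_gt0P[i0 i0U] : 0 < #|U| by lia.
have sn : #|S| <= n.
  by apply: leq_trans (cM i0); apply: subset_leq_card; rewrite inE in i0U.
have s_gt0 : 0 < #|S| by rewrite card_gt0.
have mS e : e \in S -> #|U| <= m e.
  move=> eS; apply: subset_leq_card; apply/subsetP=> i.
  by rewrite !inE => /subsetP; apply.
(* Since [S] avoids [D], every edge of [D] is missing at least as often as any edge of [S]. *)
have mD e : e \in D -> #|U| <= m e.
  move=> eD; have /set0Pn[e' e'S] := S0.
  exact: leq_trans (mS _ e'S) (heavy _ _ eD (subsetP sSKD _ e'S)).
have dSD : [disjoint S & D].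
  by move: sSKD; rewrite subsetD => /andP[].
have cSD : #|S :|: D| = #|S| + n.-1.
  by rewrite cardsU (disjoint_setI0 dSD) cards0 subn0 cD.
have bound : #|S :|: D| * #|U| <= (2 * n - 1) * n.
  apply: (@leq_trans (\sum_(e in S :|: D) m e)).
    rewrite -sum_nat_const; apply: leq_sum => e; rewrite inE => /orP[/mS//|/mD//].
  rewrite sum_multiplicity -cI -sum_nat_const.
  apply: leq_sum => i _; apply: leq_trans (cM i).
  exact: subset_leq_card (subsetIl _ _).
have : (#|S| == 1) || (#|S| == n).
  have : (#|S| + n.-1) * (2 * n - #|S|) <= (2 * n - 1) * n.
    by rewrite -cSD; apply: leq_trans bound; rewrite leq_mul2l cU_ge orbT.
  (* The inequality amounts to $(s-1)(n-s) \le 0$ with $1 \le s \le n$. *)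
  by case: (n) n2 (#|S|) sn s_gt0 => // k _ s ? ? ?; nia.
case/orP=> /eqP s1.
  (* For $s = 1$ the set [U] contains all $2n-1$ colours, so every edge of [S :|: D] is missing
     everywhere; as this set has $n$ edges, it fills each [M i]. *)
  have sSDM i : S :|: D \subset M i.
    have mfull e : #|U| <= m e -> e \in M i.
      move=> le; have : [set i | e \in M i] = setT.
        apply/eqP; rewrite eqEcard subsetT cardsT cI.
        by apply: leq_trans le; lia.
      by move/setP/(_ i); rewrite !inE.
    by apply/subsetP=> e; rewrite inE => /orP[/mS|/mD]; apply: mfull.
  exists (S :|: D); first by lia.
  by move=> i; apply/esym/eqP; rewrite eqEcard sSDM cSD s1; have := cM i; lia.
have /card_gt0P[e eD] : 0 < #|D| by rewrite cD; lia.
(* For $s = n$ the colours in [U] have [M i = S], which excludes [e]. So [m e] counts colours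
   outside [U] only, against [m e >= #|U| >= n]. *)
have : #|U| + m e <= 2 * n - 1.
  rewrite -cI -(cardC (mem U)) leq_add2l.
  apply: subset_leq_card; apply/subsetP=> i; rewrite !inE => eM.
  apply: contraL eM => sSM.
  have -> : M i = S by apply/esym/eqP; rewrite eqEcard sSM s1 cM.
  by rewrite (disjointFl dSD eD).
by have := mD _ eD; lia.
Qed.

(** * Path graphs *)

(** Kept as a list so that the edges of a path can be counted by its length once it is known to be
    duplicate-free. *)
Definition consecutive_pairs (V : finType) (w : seq V) : seq {set V} :=
  if w is x :: w' then pairmap (fun x y => [set x; y]) x w' else [::].

Lemma infix_pair_cons (V : eqType) (x y a b : V) (w : seq V) :
  infix [:: x; y] [:: a, b & w] =
  (x == a) && (y == b) || infix [:: x; y] (b :: w).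
Proof. by rewrite /= prefix0s andbT. Qed.

Lemma mem_consecutive_pairs (V : finType) (w : seq V) (e : {set V}) :
  reflect (exists x y, infix [:: x; y] w /\ e = [set x; y])
          (e \in consecutive_pairs w).
Proof.
case: w => [|a w]; first by right=> -[x [y []]].
elim: w a => [|b w IHw] a; first by right=> -[x [y []]]; rewrite /= andbF.
rewrite [consecutive_pairs _]/= inE -[pairmap _ _ _]/(consecutive_pairs (b :: w)).
apply: (iffP orP).
  case=> [/eqP->|/IHw[x [y [ixy ->]]]].
    by exists a, b; rewrite infix_pair_cons !eqxx.
  by exists x, y; rewrite infix_pair_cons ixy orbT.
case=> x [y []]; rewrite infix_pair_cons => /orP[/andP[/eqP-> /eqP->] ->|ixy e_xy].
  by left.
by right; apply/IHw; exists x, y.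
Qed.

Lemma consecutive_pairs_sub (V : finType) (w : seq V) e z :
  e \in consecutive_pairs w -> z \in e -> z \in w.
Proof.
move=> /mem_consecutive_pairs[x [y [/infixP[w1 [w2 ->]] ->]]].
by rewrite !inE !mem_cat !inE => /orP[]->; rewrite ?orbT.
Qed.

Lemma uniq_consecutive_pairs (V : finType) (w : seq V) :
  uniq w -> uniq (consecutive_pairs w).
Proof.
case: w => // a w; elim: w a => // b w IHw a /andP[aw uw] /=.
rewrite (IHw b uw) andbT; apply: contra aw => h.
by apply: (consecutive_pairs_sub (w := b :: w) h); rewrite !inE eqxx.
Qed.

Definition path_adj (V : eqType) (w : seq V) : rel V :=
  fun x y => infix [:: x; y] w || infix [:: y; x] w.

Lemma path_adj_sym (V : eqType) (w : seq V) : symmetric (path_adj w).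
Proof. by move=> x y; rewrite /path_adj orbC. Qed.

Lemma path_adj_irr (V : eqType) (w : seq V) : uniq w -> irreflexive (path_adj w).
Proof.
move=> uw x; rewrite /path_adj orbb; apply/negP=> /infixP[w1 [w2 ew]].
by move: uw; rewrite ew cat_uniq /= inE eqxx !andbF.
Qed.

Definition path_graph (V : finType) (w : seq V) (uw : uniq w) : sgraph V :=
  SGraph (path_adj_sym w) (path_adj_irr uw).

Lemma mem_edges_path_graph (V : finType) (w : seq V) (uw : uniq w) e :
  (e \in edges (path_graph uw)) = (e \in consecutive_pairs w).
Proof.
apply/imsetP/mem_consecutive_pairs.
  case=> -[x y]; rewrite inE /= => /orP[h|h] ->; first by exists x, y.
  by exists y, x; rewrite setUC.
by case=> x [y [h ->]]; exists (x, y); rewrite // inE /= /path_adj h.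
Qed.

Lemma hamilton_path_graph (V : finType) (w : seq V) (uw : uniq w) :
  (forall x, x \in w) -> hamilton_path (path_graph uw).
Proof. by move=> fw; exists w; split. Qed.

Lemma card_edges_path_graph (V : finType) (w : seq V) (uw : uniq w) :
  #|edges (path_graph uw)| = (size w).-1.
Proof.
rewrite (eq_card (mem_edges_path_graph uw)) (card_uniqP (uniq_consecutive_pairs uw)).
by case: w {uw} => //= a w; rewrite size_pairmap.
Qed.

Lemma all_consecutive_pairs (V : finType) (K : {set {set V}}) (w : seq V) :
  sorted (fun x y => [set x; y] \in K) w -> {subset consecutive_pairs w <= K}.
Proof.
case: w => // a w; elim: w a => // b w IHw a /= /andP[ab bw] e.
by rewrite inE => /orP[/eqP->//|]; apply: IHw.
Qed.

(** * From paths encoded by pairs to rainbow Hamilton paths *)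

Definition pairs_to_path (V : Type) (s : seq (V * V)) : seq V :=
  flatten [seq [:: p.1; p.2] | p <- s].

Lemma perm_pairs_to_path (V : eqType) (s : seq (V * V)) :
  perm_eq (pairs_to_path s) (unzip1 s ++ unzip2 s).
Proof.
elim: s => //= p s IHs; rewrite perm_cons -[p.2 :: unzip2 s]cat1s perm_sym.
by rewrite perm_catCA perm_sym /= perm_cons.
Qed.

Lemma sorted_pairs_to_path (V : Type) (Q : rel V) (s : seq (V * V)) :
    sorted (fun p q => Q p.2 q.1) s -> all (fun p => Q p.1 p.2) s ->
  sorted Q (pairs_to_path s).
Proof.
case: s => // p s /= + /andP[-> sQ] /=.
by elim: s p sQ => //= q s IHs p /andP[-> sQ] /andP[-> /IHs->].
Qed.

(** Disjointness tells which end of an edge lies in [X], so edges may be counted as ordered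
    pairs. *)
Lemma set2_inj_setX (V : finType) (X Y : {set V}) : [disjoint X & Y] ->
  {in setX X Y &, injective (fun p : V * V => [set p.1; p.2])}.
Proof.
move=> dXY [x y] [x' y']; rewrite !in_setX /= => /andP[xX yY] /andP[x'X y'Y] /setP e.
have neq u v : u \in X -> v \in Y -> (u == v) = false.
  by move=> uX vY; apply: contraTF uX => /eqP->; rewrite (disjointFl dXY vY).
have := e x; rewrite !inE eqxx (neq _ _ xX y'Y) orbF => /esym/eqP->.
by have := e y; rewrite !inE eqxx orbT ![y == _]eq_sym (neq _ _ x'X yY) => /esym/eqP->.
Qed.

Definition complete_edges (V : finType) (X Y : {set V}) : {set {set V}} :=
  [set [set p.1; p.2] | p in setX X Y].

(** The combinatorial half of the theorem: the spectral hypothesis enters only as the bound [n] on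
    the number of missing edges. *)
Lemma rainbow_hamilton_path_or_equal (V : finType) n (X Y : {set V})
    (G : 'I_(2 * n - 1) -> sgraph V) :
    2 <= n -> [disjoint X & Y] -> X :|: Y = [set: V] -> #|X| = n -> #|Y| = n ->
    (forall i, #|complete_edges X Y :\: edges (G i)| <= n) ->
  has_rainbow_hamilton_path G \/
  (exists2 S : {set {set V}}, #|S| = n &
     forall i, complete_edges X Y :\: edges (G i) = S).
Proof.
move=> n2 dXY XY cX cY cM; set K := complete_edges X Y in cM *.
have injXY := set2_inj_setX dXY.
have cK : #|K| = n * n by rewrite card_in_imset // cardsX cX cY.
have [|||i||[D [sDK cD assign]]|] :=
  @rainbow_assignment _ _ n K (fun i => K :\: edges (G i)).
- by rewrite card_ord.
- by [].
- by rewrite cK; nia.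
- exact: subsetDl.
- exact: cM.
(* [D'] is [D] rewritten as ordered pairs, the form in which a path can be made to avoid it. *)
- left; pose D' := [set p in setX X Y | [set p.1; p.2] \in D].
  have cD' : #|D'| <= n.-1.
    rewrite -cD -(@card_in_imset _ _ (fun p : V * V => [set p.1; p.2]) D').
      by apply/subset_leq_card/subsetP=> _ /imsetP[p + ->]; rewrite inE => /andP[].
    by move=> p q; rewrite !inE => /andP[pXY _] /andP[qXY _]; apply: injXY; rewrite inE.
  have sD' : D' \subset setX X Y by apply/subsetP=> p; rewrite inE => /andP[].
  have [s [pX pY /allP avoid srt]] := hamilton_path_avoiding cX cY sD' cD'.
  pose w := pairs_to_path s.
  have sXY p : p \in s -> (p.1 \in X) && (p.2 \in Y).
    move=> ps; rewrite -(mem_enum X) -(mem_enum Y) -(perm_mem pX) -(perm_mem pY).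
    by rewrite !map_f.
  have pw : perm_eq w (enum X ++ enum Y).
    apply: perm_trans (perm_pairs_to_path s) _.
    by apply: perm_cat.
  have uw : uniq w.
    rewrite (perm_uniq pw) cat_uniq !enum_uniq andbT /=.
    by apply/hasPn=> y; rewrite !mem_enum => yY; rewrite (disjointFl dXY yY).
  have fw x : x \in w.
    by rewrite (perm_mem pw) mem_cat !mem_enum -in_setU XY inE.
  have allowed x y : x \in X -> y \in Y -> (x, y) \notin D' -> [set x; y] \in K :\: D.
    move=> xX yY; rewrite !inE xX yY /= => -> /=.
    by apply/imsetP; exists (x, y); rewrite // inE /= xX.
  have sw : sorted (fun x y => [set x; y] \in K :\: D) w.
    apply: sorted_pairs_to_path.
      have /allP/sub_in_sorted := sXY; apply; last exact: srt.
      (* The link between successive pairs runs from [Y] back to [X], hence the swap of its ends. *)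
      by move=> p q /andP[_ p2] /andP[q1 _] /=; rewrite setUC; apply: allowed.
    apply/allP=> p ps; have /andP[p1 p2] := sXY _ ps; apply: allowed => //.
    by have := avoid _ ps; case: (p).
  have cP : #|edges (path_graph uw)| = 2 * n - 1.
    rewrite card_edges_path_graph (perm_size pw) size_cat -!cardE cX cY.
    by lia.
  have [||phi [phi_inj phiM]] := assign (edges (path_graph uw)).
  + apply/subsetP=> e; rewrite mem_edges_path_graph; exact: all_consecutive_pairs.
  + by rewrite cP.
  exists (path_graph uw); split; first exact: hamilton_path_graph.
  exists phi; split=> //.
    (* An injective colouring of the $2n-1$ path edges uses all $2n-1$ colours. *)
    by apply/eqP; rewrite eqEcard subsetT cardsT card_ord card_in_imset ?cP ?leqnn.
  move=> e eP; have := phiM _ eP; rewrite inE negb_and negbK.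
  case/orP=> // /negP[].
  have := eP; rewrite mem_edges_path_graph => /(all_consecutive_pairs sw).
  by rewrite inE => /andP[].
- by right.
Qed.

Local Open Scope ring_scope.

(** * Spectral bound *)

(** An eigenvector indexed by vertices instead of matrix indices, with the eigenvalue equation read
    at each vertex. *)
Definition eigenfunction (V : finType) (G : sgraph V) (z : algC) (v : V -> algC) :=
  (exists x, v x != 0) /\ forall x, z * v x = \sum_(y | adj G x y) v y.

(** [eigenvalue] concerns row vectors; the symmetry of [adj] turns the product into a sum over
    neighbours. *)
Lemma eigenvalue_adjacency (V : finType) (G : sgraph V) (z : algC) :
  eigenvalue (adjacency_matrix G) z <-> exists v, eigenfunction G z v.
Proof.
have sumE (u : 'rV[algC]_#|V|) x : (u *m adjacency_matrix G) 0 (enum_rank x) =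
    \sum_(y | adj G x y) u 0 (enum_rank y).
  rewrite mxE (reindex _ (onW_bij _ (@enum_rank_bij V))) /= [RHS]big_mkcond.
  apply: eq_bigr => y _; rewrite mxE !enum_rankK adj_sym.
  by case: ifP => _; rewrite ?mulr1 ?mulr0.
split.
  case/eigenvalueP=> u uA u0; exists (fun x => u 0 (enum_rank x)); split.
    have /rV0Pn[j uj] := u0.
    by exists (enum_val j); rewrite enum_valK.
  by move=> x; rewrite -sumE uA mxE.
case=> v [[x vx] vA]; apply/eigenvalueP; exists (\row_j v (enum_val j)).
  apply/rowP=> j; rewrite -(enum_valK j) sumE !mxE enum_rankK vA.
  by apply: eq_bigr => y _; rewrite mxE enum_rankK.
by apply/rV0Pn; exists (enum_rank x); rewrite mxE enum_rankK.
Qed.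

(** Cauchy-Schwarz against the constant function 1: after the triangle inequality, $2ab \le a^2 +
    b^2$ is summed over all pairs of indices. *)
Lemma normC_sum_sqr (I : finType) (P : pred I) (f : I -> algC) :
  `|\sum_(i | P i) f i| ^+ 2 <= #|P|%:R * \sum_(i | P i) `|f i| ^+ 2.
Proof.
apply: (@le_trans _ _ ((\sum_(i | P i) `|f i|) ^+ 2)).
  by rewrite lerXn2r ?nnegrE ?sumr_ge0 // ler_norm_sum.
rewrite -(ler_pMn2r (n := 2)) // expr2 big_distrlr /= -sumrMnl.
pose S := \sum_(i | P i) `|f i| ^+ 2.
apply: (@le_trans _ _ (\sum_(i | P i) (`|f i| ^+ 2 *+ #|P| + S))).
  apply: ler_sum => i _; rewrite -sumrMnl -sumr_const -big_split /=.
  apply: ler_sum => j _; apply: (real_leif_mean_square_scaled _ _).1;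
    exact: normr_real.
by rewrite big_split /= sumrMnl sumr_const -/S mulr_natl mulr2n.
Qed.

Definition bipartite (V : finType) (G : sgraph V) (X Y : {set V}) : Prop :=
  [/\ [disjoint X & Y], X :|: Y = [set: V] &
      forall x y, adj G x y -> (x \in X) && (y \in Y) || (x \in Y) && (y \in X)].

Lemma bipartite_sym (V : finType) (G : sgraph V) (X Y : {set V}) :
  bipartite G X Y -> bipartite G Y X.
Proof.
case=> dXY XY adjXY; split; rewrite ?(disjoint_sym Y) // 1?setUC //.
by move=> x y /adjXY; rewrite orbC.
Qed.

Lemma bipartite_adj (V : finType) (G : sgraph V) (X Y : {set V}) x y :
  bipartite G X Y -> x \in X -> adj G x y -> y \in Y.
Proof.
case=> dXY _ adjXY xX /adjXY; rewrite xX /= => /orP[//|/andP[xY _]].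
by rewrite (disjointFr dXY xX) in xY.
Qed.

Lemma edges_bipartite (V : finType) (G : sgraph V) (X Y : {set V}) :
    bipartite G X Y ->
  edges G = [set [set p.1; p.2] | p in [set p in setX X Y | adj G p.1 p.2]].
Proof.
move=> bG; have [_ _ adjXY] := bG; apply/setP=> e; apply/imsetP/imsetP.
  case=> -[x y]; rewrite inE /= => xy ->; case/orP: (adjXY _ _ xy) => /andP[xX yY].
    by exists (x, y); rewrite // !inE /= xX yY.
  by exists (y, x); rewrite 1?setUC // !inE /= adj_sym xX yY.
by case=> p; rewrite inE => /andP[_ ?] ->; exists p; rewrite ?inE.
Qed.

Lemma card_edges_bipartite (V : finType) (G : sgraph V) (X Y : {set V}) :
  bipartite G X Y -> #|edges G| = #|[set p in setX X Y | adj G p.1 p.2]|.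
Proof.
move=> bG; rewrite (edges_bipartite bG) card_in_imset // => p q.
rewrite ![_ \in [set _ | _]]inE => /andP[pXY _] /andP[qXY _].
by case: bG => dXY _ _; apply: (set2_inj_setX dXY); rewrite inE.
Qed.

(** Each edge has exactly one end in [X]. *)
Lemma sum_degrees_bipartite (V : finType) (G : sgraph V) (X Y : {set V}) :
  bipartite G X Y -> (\sum_(x in X) #|adj G x|)%N = #|edges G|.
Proof.
move=> bG; rewrite (card_edges_bipartite bG) -sum1_card.
rewrite (eq_bigr (fun x => \sum_(y | adj G x y) 1)%N) => [|x _].
  2: by rewrite sum1_card.
rewrite pair_big_dep /=; apply: eq_bigl => -[x y]; rewrite !inE /=.
case xX: (x \in X) => //=; case xy: (adj G x y); rewrite ?andbF //.
by rewrite (bipartite_adj bG xX xy).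
Qed.

(** * The bound of $|z|^2$ by the number of edges, and its equality case *)

Section BipartiteSpectrum.
Variables (V : finType) (G : sgraph V) (z : algC) (v : V -> algC).
Hypothesis ev : eigenfunction G z v.

Let mass (A : {set V}) := \sum_(x in A) `|v x| ^+ 2.

Local Lemma mass_ge0 A : 0 <= mass A.
Proof. by apply: sumr_ge0 => x _; rewrite exprn_ge0. Qed.

Local Lemma eigen_bound x :
  `|z| ^+ 2 * `|v x| ^+ 2 <= #|adj G x|%:R * \sum_(y | adj G x y) `|v y| ^+ 2.
Proof. by rewrite -exprMn -normrM ev.2; apply: normC_sum_sqr. Qed.

Local Lemma eigen_bound_part X Y x : bipartite G X Y -> x \in X ->
  `|z| ^+ 2 * `|v x| ^+ 2 <= #|adj G x|%:R * mass Y.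
Proof.
(* The neighbours of [x] all lie in [Y], so their sum is at most [mass Y]. *)
move=> bG xX; apply: le_trans (eigen_bound x) _; rewrite ler_wpM2l //.
rewrite [mass Y](bigID (adj G x)) /=.
rewrite [X in _ <= X + _](eq_bigl (adj G x)) ?lerDl ?sumr_ge0 //.
  by move=> y _; rewrite exprn_ge0.
by move=> y; case xy: (adj G x y); rewrite ?andbF // (bipartite_adj bG xX xy).
Qed.

Local Lemma eigen_bound_mass X Y : bipartite G X Y ->
  `|z| ^+ 2 * mass X <= #|edges G|%:R * mass Y.
Proof.
move=> bG; rewrite -(sum_degrees_bipartite bG) natr_sum mulr_sumr mulr_suml.
by apply: ler_sum => x; apply: eigen_bound_part.
Qed.

Local Lemma mass_gt0 X Y : bipartite G X Y -> 0 < mass X + mass Y.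
Proof.
case=> _ XY _; have [[x vx] _] := ev.
have pos (A : {set V}) : x \in A -> 0 < mass A.
  move=> xA; rewrite /mass (bigD1 x) //= ltr_wpDr ?exprn_gt0 ?normr_gt0 //.
  by apply: sumr_ge0 => y _; rewrite exprn_ge0.
have : x \in X :|: Y by rewrite XY.
rewrite inE => /orP[/pos h|/pos h]; first by rewrite ltr_wpDr ?mass_ge0.
by rewrite ltr_wpDl ?mass_ge0.
Qed.

(** The bounds of [mass X] by [mass Y] and of [mass Y] by [mass X] are added, then divided by the
    positive total mass. *)
Lemma eigenvalue_sqr_le_edges X Y : bipartite G X Y -> `|z| ^+ 2 <= #|edges G|%:R.
Proof.
move=> bG; rewrite -(ler_pM2r (mass_gt0 bG)) mulrDr mulrDr.
by rewrite [leRHS]addrC lerD ?eigen_bound_mass //; apply: bipartite_sym.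
Qed.

(** Equality makes the two masses equal and the Cauchy-Schwarz bound tight at every vertex. A
    non-isolated [y] then has [v y] nonzero, and leaving it out of the neighbourhood of [x] would
    make the bound at [x] strict. *)
Lemma eigenvalue_sqr_eq_edges X Y x y :
    bipartite G X Y -> (0 < #|edges G|)%N -> #|edges G|%:R <= `|z| ^+ 2 ->
    x \in X -> y \in Y -> (0 < #|adj G x|)%N -> (0 < #|adj G y|)%N -> adj G x y.
Proof.
move=> bG e_gt0 ez xX yY dx dy.
have z2 : `|z| ^+ 2 = #|edges G|%:R.
  by apply/eqP; rewrite eq_le ez (eigenvalue_sqr_le_edges bG).
have z2_gt0 : 0 < `|z| ^+ 2 by rewrite z2 ltr0n.
have mXY : mass X = mass Y.
  apply/eqP; rewrite eq_le -(ler_pM2l z2_gt0) {2}z2 eigen_bound_mass //=.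
  by rewrite -(ler_pM2l z2_gt0) {2}z2 eigen_bound_mass //; apply: bipartite_sym.
have mY : 0 < mass Y.
  by have := mass_gt0 bG; rewrite mXY -mulr2n pmulrn_lgt0.
have tight A B u : bipartite G A B -> mass A = mass B -> u \in A ->
    `|z| ^+ 2 * `|v u| ^+ 2 = #|adj G u|%:R * mass B.
  move=> bAB mAB uA; apply/eqP; rewrite eq_sym -subr_eq0.
  (* The differences are nonnegative and sum to zero, so each of them vanishes. *)
  have : \sum_(t in A) (#|adj G t|%:R * mass B - `|z| ^+ 2 * `|v t| ^+ 2) == 0.
    rewrite sumrB -mulr_suml -mulr_sumr -natr_sum (sum_degrees_bipartite bAB).
    by rewrite -z2 -mAB subrr.
  rewrite psumr_eq0 => [/allP/(_ u)|t tA].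
    2: by rewrite subr_ge0 (eigen_bound_part bAB).
  by rewrite mem_index_enum uA /=; apply.
apply: contraT => nxy.
have vy : 0 < `|v y| ^+ 2.
  rewrite -(pmulr_rgt0 _ z2_gt0) (tight Y X) ?mXY //; last exact: bipartite_sym.
  by rewrite mulr_gt0 ?ltr0n.
have := eigen_bound x; rewrite (tight X Y) // ler_pM2l ?ltr0n //.
rewrite lt_geF // [mass Y](bigID (adj G x)) /=.
rewrite [X in _ < X + _](eq_bigl (adj G x)); last first.
  by move=> t; case xt: (adj G x t); rewrite ?andbF // (bipartite_adj bG xX xt).
rewrite ltrDl (bigD1 y) /= ?yY ?nxy // ltr_wpDr // sumr_ge0 // => t _.
by rewrite exprn_ge0.
Qed.

End BipartiteSpectrum.

(** * The extremal graph *)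

(** An explicit eigenfunction: $n-1$ on the part of size $n$, $\sqrt{n(n-1)}$ on the part of size
    $n-1$, and 0 at the isolated vertex. *)
Lemma rho_extremal_graph n :
  (2 <= n)%N -> sqrtC (n * n.-1)%:R <= rho (extremal_graph n).
Proof.
move=> n2; set l := sqrtC _.
have l2 : l ^+ 2 = (n * n.-1)%:R by rewrite sqrtCK.
have l0 : 0 <= l by rewrite sqrtC_ge0 ler0n.
pose v (x : ('I_n + 'I_n.-1) + 'I_1) : algC :=
  match x with inl (inl _) => n.-1%:R | inl (inr _) => l | inr _ => 0 end.
have ev : eigenvalue (adjacency_matrix (extremal_graph n)) l.
  apply/eigenvalue_adjacency; exists v; split.
    by exists (inl (inl (Ordinal (ltnW n2)))); rewrite /= pnatr_eq0; lia.
  move=> x; rewrite big_mkcond !big_sumType /= big_ord1.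
  case: x => [[i|j]|k] /=;
    rewrite ?if_same ?(big1 _ _ (fun _ _ => erefl)) ?sumr_const ?card_ord;
    rewrite ?mul0rn ?addr0 ?add0r ?mulr0 //.
  - by rewrite mulr_natr.
  - by rewrite -expr2 l2 mulnC natrM mulr_natr.
by have := spectral_radius_max ev; rewrite ger0_norm.
Qed.

Lemma injection_into_ord (T : finType) (A : {set T}) m :
  (0 < m)%N -> #|A| = m -> exists r : T -> 'I_m, {in A &, injective r}.
Proof.
case: m => // m _ cA; exists (fun x => inord (index x (enum A))) => x y xA yA.
have lt t : t \in A -> (index t (enum A) < m.+1)%N.
  by move=> tA; rewrite -cA cardE index_mem mem_enum.
move/(congr1 (@nat_of_ord _)); rewrite !inordK ?lt // => e.
by rewrite -[LHS](@nth_index _ x x (enum A)) ?mem_enum // e nth_index ?mem_enum.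
Qed.

(** [X] goes to the part of size [n], [B] to the part of size [n.-1], and the single vertex [t] of
    [Y :\: B] to the isolated vertex. *)
Lemma isomorphic_extremal_graph (V : finType) (G : sgraph V) n (X Y B : {set V}) :
    (2 <= n)%N -> [disjoint X & Y] -> X :|: Y = [set: V] ->
    #|X| = n -> #|Y| = n -> B \subset Y -> #|B| = n.-1 ->
    (forall x y, adj G x y = (x \in X) && (y \in B) || (x \in B) && (y \in X)) ->
  isomorphic G (extremal_graph n).
Proof.
move=> n2 dXY XY cX cY sBY cB adjE.
have [|f f_inj] := injection_into_ord _ cX; first by lia.
have [|g g_inj] := injection_into_ord _ cB; first by lia.
have /cards1P[t YB] : #|Y :\: B| == 1%N.
  by rewrite cardsD (setIidPr sBY) cY cB; apply/eqP; lia.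
have dXB x : x \in X -> x \notin B.
  by move=> xX; apply: contraFN (disjointFr dXY xX) => /(subsetP sBY).
have outside x : x \notin X -> x \notin B -> x = t.
  move=> nX nB; apply/set1P; rewrite -YB inE nB /=.
  by have : x \in X :|: Y; rewrite XY // -XY inE (negPf nX).
pose h x : ('I_n + 'I_n.-1) + 'I_1 :=
  if x \in X then inl (inl (f x)) else
  if x \in B then inl (inr (g x)) else inr ord0.
have h_inj : injective h.
  move=> x y; rewrite /h.
  case: ifPn => xX; [|case: ifPn => xB]; (case: ifPn => yX; [|case: ifPn => yB]) => //.
  + by case=> /f_inj; apply.
  + by case=> /g_inj; apply.
  + by rewrite (outside x) // (outside y).
exists h.
  apply: inj_card_bij => //.
  rewrite !card_sum !card_ord -cardsT -XY cardsU (disjoint_setI0 dXY) cards0.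
  by rewrite cX cY; lia.
move=> x y; rewrite adjE /h.
have [xX|_] := boolP (x \in X); have [yX|_] := boolP (y \in X);
  rewrite ?(negPf (dXB _ xX)) ?(negPf (dXB _ yX)) ?andbF ?andbT ?orbF //=;
  by do !case: ifP.
Qed.

(** The equality case of the spectral bound makes [G] complete between its non-isolated vertices
    [X'] and [Y'], whose sizes then have product $n(n-1)$. *)
Lemma isomorphic_extremal_of_edges (V : finType) (G : sgraph V) n (X Y : {set V}) :
    (2 <= n)%N -> bipartite G X Y -> #|X| = n -> #|Y| = n ->
    #|edges G| = (n * n.-1)%N -> (n * n.-1)%:R <= rho G ^+ 2 ->
  isomorphic G (extremal_graph n).
Proof.
move=> n2 bG cX cY cE hrho.
have [dXY XY adjXY] := bG.
have [|z zG ez] := @spectral_radius_attained _ (adjacency_matrix G).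
  by rewrite -cardsT -XY cardsU cX (disjoint_setI0 dXY) cards0; lia.
have /eigenvalue_adjacency[v ev] := zG.
have E0 : (0 < #|edges G|)%N by rewrite cE; nia.
pose X' := [set x in X | (0 < #|adj G x|)%N].
pose Y' := [set y in Y | (0 < #|adj G y|)%N].
have full x y : x \in X' -> y \in Y' -> adj G x y.
  rewrite !inE => /andP[xX dx] /andP[yY dy].
  by apply: (eigenvalue_sqr_eq_edges ev bG) => //; rewrite cE ez.
have deg x y : adj G x y -> (0 < #|adj G x|)%N by move=> xy; apply/card_gt0P; exists y.
have adjE x y : adj G x y = (x \in X') && (y \in Y') || (x \in Y') && (y \in X').
  apply/idP/idP => [xy|/orP[]/andP[xX yY]]; last 2 first.
  - exact: full.
  - by rewrite adj_sym full.
  by rewrite !inE (deg _ _ xy) (deg y x) ?andbT ?adjXY // adj_sym.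
have sX : X' \subset X by apply/subsetP=> x; rewrite inE => /andP[].
have sY : Y' \subset Y by apply/subsetP=> y; rewrite inE => /andP[].
have cXY : (#|X'| * #|Y'|)%N = (n * n.-1)%N.
  rewrite -cE (card_edges_bipartite bG) -cardsX; apply: eq_card => -[x y].
  apply/setXP/idP => [[xX yY]|].
    by rewrite inE in_setX /= (subsetP sX) // (subsetP sY) // full.
  rewrite inE in_setX /= => /andP[/andP[xX yY] xy].
  by rewrite !inE xX yY (deg _ _ xy) (deg y x) // adj_sym.
have leX : (#|X'| <= n)%N by rewrite -cX subset_leq_card.
have leY : (#|Y'| <= n)%N by rewrite -cY subset_leq_card.
have [cX'|cX'] := eqVneq #|X'| n.
  have eX : X' = X by apply/eqP; rewrite eqEcard sX cX cX' /=.
  apply: (@isomorphic_extremal_graph _ G n X Y Y') => //.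
    by move: cXY; rewrite cX' => /eqP; rewrite eqn_pmul2l; [move/eqP|lia].
  by rewrite -eX.
(* If both sizes were below $n$, their product would be at most $(n-1)^2 < n(n-1)$. *)
have [cY'|cY'] := eqVneq #|Y'| n; last by nia.
have eY : Y' = Y by apply/eqP; rewrite eqEcard sY cY cY' /=.
apply: (@isomorphic_extremal_graph _ G n Y X X') => //.
- by rewrite disjoint_sym.
- by rewrite setUC.
- by move: cXY; rewrite cY' mulnC => /eqP; rewrite eqn_pmul2l; [move/eqP|lia].
- by move=> x y; rewrite adjE eY orbC.
Qed.

Theorem theorem1p3 (n : nat) (hn : (2 <= n)%N)
    (X Y : {set 'I_(2 * n)%N})
    (G : 'I_(2 * n - 1)%N -> sgraph 'I_(2 * n)%N)
    (hG : forall i, balanced_bipartite (G i) X Y)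
    (hrho : forall i, rho (extremal_graph n) <= rho (G i)) :
  has_rainbow_hamilton_path G \/
  ((forall i j, edges (G i) = edges (G j)) /\
   (forall i, isomorphic (G i) (extremal_graph n))).
Proof.
have bG i : bipartite (G i) X Y by case: (hG i).
have N0 : (0 < 2 * n - 1)%N by lia.
have [dXY XY cXeqY _] := hG (Ordinal N0).
have cX : #|X| = n.
  have : #|X :|: Y| = (2 * n)%N by rewrite XY cardsT card_ord.
  by rewrite cardsU (disjoint_setI0 dXY) cards0 -cXeqY; lia.
have cY : #|Y| = n by rewrite -cXeqY.
have rho_ge i : (n * n.-1)%:R <= rho (G i) ^+ 2.
  have le_rho := le_trans (rho_extremal_graph hn) (hrho i).
  rewrite -[leLHS]sqrtCK lerXn2r // nnegrE ?sqrtC_ge0 ?ler0n //.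
  by apply: le_trans le_rho; rewrite sqrtC_ge0 ler0n.
have cK : #|complete_edges X Y| = (n * n)%N.
  by rewrite (card_in_imset (set2_inj_setX dXY)) cardsX cX cY.
have sE i : edges (G i) \subset complete_edges X Y.
  rewrite (edges_bipartite (bG i)); apply/subsetP=> _ /imsetP[p + ->].
  by rewrite inE => /andP[pXY _]; apply: imset_f.
have cE i : (#|edges (G i)| + #|complete_edges X Y :\: edges (G i)|)%N = (n * n)%N.
  by rewrite -cK -(cardsID (edges (G i)) (complete_edges X Y)) (setIidPr (sE i)).
(* An eigenvalue of largest modulus turns the bound on [rho] into a bound on the number of edges. *)
have eE i : (n * n.-1 <= #|edges (G i)|)%N.
  have [|z zG ez] := @spectral_radius_attained _ (adjacency_matrix (G i)).
    by rewrite card_ord; lia.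
  have /eigenvalue_adjacency[v ev] := zG.
  have := le_trans (rho_ge i) _; rewrite /rho -ez -(ler_nat algC); apply.
  exact: eigenvalue_sqr_le_edges ev _ _ (bG i).
have [i|//|[S cS eS]] := @rainbow_hamilton_path_or_equal _ n X Y G hn dXY XY cX cY.
(* At most $n^2 - n(n-1) = n$ edges are missing from each graph. *)
- by have := cE i; have := eE i; nia.
- by left.
right; split=> [i j|i].
  have eqE k : edges (G k) = complete_edges X Y :\: S.
    by rewrite -(eS k) setDDr setDv set0U (setIidPr (sE k)).
  by rewrite !eqE.
apply: isomorphic_extremal_of_edges hn (bG i) cX cY _ (rho_ge i).
(* Exactly [n] missing edges leave $n(n-1)$, the equality case. *)
by have := cE i; rewrite eS cS; nia.
Qed.
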